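(* Let $k,r\ge 2$ be integers, let $q=\frac{r^k-1}{r-1}$, and let $G$ be the complete $k$-partite $k$-uniform hypergraph with parts $U_1,\ldots,U_k$ such that $|U_i|=m^{r^{i-1}/q}$ for $1\le i\le k$ (with $m$ such that these are integers). Then $G$ has $m$ edges, and every subhypergraph of $G$ containing no copy of $K^{(k)}_{r,\ldots,r}$ has $O(m^{(q-1)/q})$ edges, where the implied constant depends only on $k$ and $r$.
   Context: $K^{(k)}_{r,\ldots,r}$ denotes the complete $k$-partite $k$-uniform hypergraph with $k$ parts each of order $r$. The complete $k$-partite $k$-uniform hypergraph with parts $U_1,\dots,U_k$ has as edges all $k$-sets containing exactly one vertex from each $U_i$. *)

(* Defs.v *)
From mathcomp Require Import all_boot all_order all_algebra.
From mathcomp Require Import reals exp.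
Set Implicit Arguments.
Unset Strict Implicit.
Unset Printing Implicit Defensive.
Import Order.TTheory GRing.Theory Num.Theory.

Record hypergraph (T : finType) := Hypergraph {
  verts : {set T};
  edges : {set {set T}};
  edges_verts : forall e, e \in edges -> e \subset verts
}.

Definition subhypergraph (T : finType) (H G : hypergraph T) : Prop :=
  verts H \subset verts G /\ edges H \subset edges G.

Section CompletePartite.
Variables (T : finType) (k : nat) (U : 'I_k -> {set T}).

Definition partite_verts : {set T} := \bigcup_(i < k) U i.

Definition partite_edges : {set {set T}} :=
  [set e : {set T} | [&& e \subset partite_verts, #|e| == k
                       & [forall i : 'I_k, #|e :&: U i| == 1]]].

Lemma partite_edges_verts e : e \in partite_edges -> e \subset partite_verts.
Proof. by rewrite inE => /and3P[]. Qed.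

(* Meaningful when the parts U i are pairwise disjoint. *)
Definition complete_partite : hypergraph T := Hypergraph partite_edges_verts.

End CompletePartite.

(* K^(k)_{r,...,r}: the vertex (i, j) is the j-th vertex of the i-th part. *)
Definition complete_partite_r (k r : nat) : hypergraph ('I_k * 'I_r)%type :=
  complete_partite (fun i : 'I_k => [set x : 'I_k * 'I_r | x.1 == i]).

(* A copy of F in H is a not necessarily induced subhypergraph of H isomorphic
   to F, given by the embedding f. *)
Definition contains_copy (S T : finType) (F : hypergraph S) (H : hypergraph T)
    : Prop :=
  exists f : S -> T,
    [/\ {in verts F &, injective f},
        forall v, v \in verts F -> f v \in verts H
      & forall e, e \in edges F -> f @: e \in edges H].

Definition geom_q (R : realType) (k r : nat) : R :=
  ((r%:R ^+ k - 1) / (r%:R - 1))%R.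

(* Main.v *)
Require Import Defs.
From mathcomp Require Import all_boot all_order all_algebra.
From mathcomp Require Import reals exp.
Set Implicit Arguments.
Unset Strict Implicit.
Unset Printing Implicit Defensive.
Import Order.TTheory GRing.Theory Num.Theory.
Local Open Scope ring_scope.

(** The part sizes are [t ^ (r ^ i)] for [t = m ^ (1 / q)], so [m = t ^ q] and
    the claim is that a hypergraph without [K_{r,...,r}] has at most
    [k (r - 1) t ^ (q - 1)] edges, which is proved by induction on [k].  Each
    vertex [y] of the last part has a link, a hypergraph on the first [k - 1]
    parts.  Deleting one edge from every copy of [K^(k-1)_{r,...,r}] in the link
    leaves a hypergraph to which the induction hypothesis applies, so the link
    has at most [(k - 1)(r - 1) t ^ (q' - 1)] edges plus its number of copies,
    where [q = r q' + 1 = q' + r ^ (k - 1)].  A given copy lies in at most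
    [r - 1] links, since [r] of them would form a copy of [K^(k)_{r,...,r}], and
    there are at most [t ^ (r q')] copies in all; now sum over the
    [t ^ (r ^ (k - 1))] vertices [y]. *)

(** * Splitting off the last coordinate of a choice function *)

Section FfunRcons.
Local Open Scope nat_scope.
Variables (T : finType) (k : nat).

Definition ffun_rcons (e : {ffun 'I_k -> T}) (y : T) : {ffun 'I_k.+1 -> T} :=
  [ffun i => if unlift ord_max i is Some j then e j else y].

Lemma ffun_rcons_lift e y j : ffun_rcons e y (lift ord_max j) = e j.
Proof. by rewrite ffunE liftK. Qed.

Lemma ffun_rcons_max e y : ffun_rcons e y ord_max = y.
Proof. by rewrite ffunE unlift_none. Qed.

Lemma ffun_rconsK (f : {ffun 'I_k.+1 -> T}) :
  ffun_rcons [ffun j => f (lift ord_max j)] (f ord_max) = f.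
Proof.
by apply/ffunP=> i; rewrite ffunE; case: unliftP => [j|] ->; rewrite ?ffunE.
Qed.

Lemma card_ffun_rcons (H : {set {ffun 'I_k.+1 -> T}}) (V : {set T}) :
  (forall f, f \in H -> f ord_max \in V) ->
  #|H| = \sum_(y in V) #|[set e | ffun_rcons e y \in H]|.
Proof.
move=> HV; pose last_vertex (f : {ffun 'I_k.+1 -> T}) := f ord_max.
rewrite -sum1_card (partition_big last_vertex (mem V)) //=.
apply: eq_bigr => y _; rewrite sum1dep_card.
have inj : injective (ffun_rcons^~ y).
  by move=> e1 e2 /ffunP E; apply/ffunP=> j; have := E (lift ord_max j);
     rewrite !ffun_rcons_lift.
rewrite -(card_imset _ inj); apply: eq_card => f; rewrite inE.
apply/andP/imsetP => [[Hf /eqP fy]|[e]].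
  exists [ffun j => f (lift ord_max j)]; last by rewrite -fy ffun_rconsK.
  by rewrite inE -fy ffun_rconsK.
by rewrite inE => He ->; rewrite He /last_vertex ffun_rcons_max.
Qed.

End FfunRcons.

(* Edges are encoded by choice functions on the parts; [F i] lists the [r]
   vertices of the copy in part [i]. *)
Definition is_copy (T : finType) (r k : nat) (H : {set {ffun 'I_k -> T}})
    (F : {ffun 'I_k -> {ffun 'I_r -> T}}) : bool :=
  [forall i, injectiveb (F i)] &&
  [forall j : {ffun 'I_k -> 'I_r}, [ffun i => F i (j i)] \in H].
Arguments is_copy {T} r {k} H F.

Section PartiteTuran.
Local Open Scope nat_scope.

Variables (T : finType) (r t : nat).
Hypothesis r_gt0 : 0 < r.

(** The inner set is the link of [y]. *)
Definition copies_through k (H : {set {ffun 'I_k.+1 -> T}}) y :=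
  [set F | is_copy r [set e | ffun_rcons e y \in H] F].

Lemma is_copy_ffun_rcons k (H : {set {ffun 'I_k.+1 -> T}}) F
    (g : {ffun 'I_r -> T}) :
  injective g -> (forall a, F \in copies_through H (g a)) ->
  is_copy r H (ffun_rcons F g).
Proof.
move=> ginj Fg; apply/andP; split; apply/forallP.
  move=> i; rewrite ffunE; case: unlift => [j|]; last exact/injectiveP.
  by have := Fg (Ordinal r_gt0); rewrite inE => /andP[/forallP/(_ j)].
move=> j; have := Fg (j ord_max); rewrite inE => /andP[_ /forallP].
move=> /(_ [ffun i => j (lift ord_max i)]); rewrite inE.
set e1 := ffun_rcons _ _; set e2 := finfun _; suff -> : e1 = e2 by [].
apply/ffunP=> i; rewrite /e1 /e2 !ffunE.
by case: unliftP => [a|] ->; rewrite ?ffunE.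
Qed.

Lemma card_copies_through k (H : {set {ffun 'I_k.+1 -> T}}) F :
  ~~ [exists F, is_copy r H F] ->
  #|[set y | F \in copies_through H y]| <= r.-1.
Proof.
(* If at least [r] vertices have [F] in their links, the first [r] of them in the enumeration serve
   as the last part of a copy in [H]. *)
move=> noK; rewrite leqNgt; apply: contra noK; rewrite prednK // => rY.
have gF a : F \in copies_through H (enum_val (widen_ord rY a)).
  by have := enum_valP (widen_ord rY a); rewrite inE.
apply/existsP; exists (ffun_rcons F [ffun a => enum_val (widen_ord rY a)]).
apply: is_copy_ffun_rcons => [a b|a]; rewrite !ffunE //.
by move/enum_val_inj => /(congr1 val)/= ab; apply: val_inj.
Qed.

(** Each copy loses its edge of index 0 in every part. A copy surviving in [L'] would be one of the
    copies in [L], whose chosen edge is gone. *)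
Lemma delete_copies k (L : {set {ffun 'I_k -> T}}) :
  exists2 L' : {set {ffun 'I_k -> T}}, L' \subset L &
    ~~ [exists F, is_copy r L' F] /\
    #|L| <= #|L'| + #|[set F | is_copy r L F]|.
Proof.
pose P := [set F | is_copy r L F].
pose edge (F : {ffun 'I_k -> {ffun 'I_r -> T}}) : {ffun 'I_k -> T} :=
  [ffun i => F i (Ordinal r_gt0)].
exists (L :\: edge @: P); first exact: subsetDl.
split; last first.
  rewrite -(cardsID (edge @: P) L) addnC leq_add2l.
  exact: leq_trans (subset_leq_card (subsetIr _ _)) (leq_imset_card _ _).
apply/existsP=> -[F /andP[Finj /forallP FL]].
have := FL [ffun=> Ordinal r_gt0]; rewrite inE => /andP[/imsetP[]].
exists F; last by apply/ffunP=> i; rewrite !ffunE.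
rewrite inE /is_copy Finj; apply/forallP=> j.
by have := FL j; rewrite inE => /andP[].
Qed.

(* Stated with a factor [t] on the left so that it also makes sense for
   [k = 0], where the exponent [\sum_(i < k) r ^ i - 1] would be negative. *)
Lemma partite_turan k (U : 'I_k -> {set T}) (H : {set {ffun 'I_k -> T}}) :
  (forall i, #|U i| = t ^ (r ^ i)) ->
  (forall e, e \in H -> forall i, e i \in U i) ->
  ~~ [exists F, is_copy r H F] ->
  #|H| * t <= k * r.-1 * t ^ (\sum_(i < k) r ^ i).
Proof.
elim: k => [|k IH] in U H * => cU HU noK.
  (* For [k = 0], any element of [H] would make the empty family a copy. *)
  suff -> : H = set0 by rewrite cards0.
  apply/setP=> e; rewrite inE; apply: contraNF noK => He.
  apply/existsP; exists [ffun i => [ffun=> e i]]; apply/andP; split.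
    by apply/forallP; case.
  by apply/forallP=> j; rewrite (_ : finfun _ = e) //; apply/ffunP; case.
set q := \sum_(i < k) r ^ i in IH.
(* The first form of the exponent fits the induction bound summed over the last part, the second
   fits the count of copies. *)
have bigq : \sum_(i < k.+1) r ^ i = q + r ^ k by rewrite big_ord_recr.
have bigq' : \sum_(i < k.+1) r ^ i = (r * q).+1.
  rewrite big_ord_recl expn0 add1n big_distrr; congr _.+1.
  by apply: eq_bigr => i _; rewrite expnS.
pose U' i := U (lift ord_max i).
have cU' i : #|U' i| = t ^ (r ^ i) by rewrite cU lift_max.
have LU y e : ffun_rcons e y \in H -> forall i, e i \in U' i.
  by move=> /HU eU i; have := eU (lift ord_max i); rewrite ffun_rcons_lift.
pose L y := [set e | ffun_rcons e y \in H].
have link y : #|L y| * t <= k * r.-1 * t ^ q + #|copies_through H y| * t.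
  have [L' L'L [noL' cL]] := delete_copies (L y).
  apply: leq_trans (leq_mul cL (leqnn t)) _; rewrite mulnDl leq_add2r.
  apply: (IH U') => // e /(subsetP L'L); rewrite inE; exact: LU.
have total : \sum_(y in U ord_max) #|copies_through H y| <= r.-1 * t ^ (r * q).
  (* All lists of [r] vertices in each part, repetitions allowed: an upper bound for the possible
     copies. *)
  pose FF := family (fun i => ffun_on (U' i) : pred {ffun 'I_r -> T}).
  have cFF : #|FF| = t ^ (r * q).
    rewrite card_family foldrE big_map big_enum /= big_distrr expn_sum.
    apply: eq_bigr => i _; rewrite card_ffun_on card_ord cU' -expnM mulnC //.
  have inFF y F : F \in copies_through H y -> F \in FF.
    rewrite inE => /andP[_ /forallP FL]; apply/familyP=> i.
    apply/ffun_onP=> a; have := FL [ffun=> a]; rewrite inE.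
    by move/LU=> /(_ i); rewrite !ffunE.
  under eq_bigr => y _ do rewrite -sum1_card.
  (* Double counting: for each [F], count the links containing it. *)
  rewrite (exchange_big_dep (mem FF)) /=; last by move=> y F _; apply: inFF.
  rewrite -cFF mulnC -sum_nat_const; apply: leq_sum => F _.
  rewrite sum1dep_card; apply: leq_trans (card_copies_through F noK).
  by apply/subset_leq_card/subsetP=> y; rewrite !inE => /andP[].
rewrite (@card_ffun_rcons _ _ _ (U ord_max)); last by move=> f /HU; apply.
rewrite big_distrl /=.
apply: leq_trans (leq_sum _ (fun y _ => link y)) _.
rewrite big_split /= sum_nat_const -big_distrl /= cU /=.
apply: (@leq_trans (t ^ (r ^ k) * (k * r.-1 * t ^ q) + r.-1 * t ^ (r * q) * t)).
  by rewrite leq_add2l leq_mul2r total orbT.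
rewrite mulSn mulnDl addnC leq_add //; first by rewrite bigq' expnSr mulnA.
by rewrite mulnC bigq expnD !mulnA.
Qed.

End PartiteTuran.

(** * Edges as sets versus edges as choice functions *)

Section PartiteEdges.
Local Open Scope nat_scope.
Variables (T : finType) (k : nat) (U : 'I_k -> {set T}).
Hypothesis disjU : forall i j : 'I_k, i != j -> [disjoint U i & U j].

Definition choice_fun (x : {ffun 'I_k -> T}) : Prop := forall i, x i \in U i.

(** Disjointness of the parts lets a choice function be read off from its edge. *)
Lemma choice_fun_setI x i :
  choice_fun x -> [set x j | j : 'I_k] :&: U i = [set x i].
Proof.
move=> xU; apply/setP=> v; rewrite !inE.
apply/andP/eqP => [[/imsetP[j _ ->] ji]|->]; last by rewrite imset_f ?xU.
have [-> //|/disjU/pred0P/(_ (x j))] := eqVneq j i.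
by rewrite /= xU ji.
Qed.

Lemma choice_fun_imset_inj x y : choice_fun x -> choice_fun y ->
  [set x i | i : 'I_k] = [set y i | i : 'I_k] -> x = y.
Proof.
move=> xU yU E; apply/ffunP=> i; apply: set1_inj.
by rewrite -(choice_fun_setI i xU) E choice_fun_setI.
Qed.

Lemma choice_fun_inj x : choice_fun x -> injective x.
Proof.
move=> xU i j xij; apply: contraTeq (xU i) => /disjU/pred0P/(_ (x j)).
by rewrite /= xU -xij => /negbT; rewrite andbT.
Qed.

Lemma partite_edgesP e :
  reflect (exists2 x : {ffun 'I_k -> T}, choice_fun x & e = [set x i | i : 'I_k])
          (e \in partite_edges U).
Proof.
apply: (iffP idP) => [|[x xU ->]].
  rewrite inE => /and3P[eU _ /forallP e1].
  have /fin_all_exists[x xP] i : exists v, e :&: U i = [set v].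
    by apply/cards1P.
  have xeU i : x i \in e :&: U i by rewrite xP set11.
  exists (finfun x) => [i|]; first by have := xeU i; rewrite ffunE inE => /andP[].
  apply/setP=> v; apply/idP/imsetP => [ve|[i _ ->]]; last first.
    by have := xeU i; rewrite ffunE inE => /andP[].
  have /bigcupP[i _ vU] := subsetP eU _ ve.
  by exists i => //; rewrite ffunE; apply/set1P; rewrite -xP inE ve.
rewrite inE; apply/and3P; split.
- apply/subsetP=> _ /imsetP[i _ ->]; apply/bigcupP; by exists i.
- by rewrite card_imset ?card_ord //; apply: choice_fun_inj.
- by apply/forallP=> i; rewrite choice_fun_setI ?cards1.
Qed.

Lemma card_edges_choice_fun (E : {set {set T}}) : E \subset partite_edges U ->
  #|E| = #|[set x : {ffun 'I_k -> T} |
            [forall i, x i \in U i] && ([set x i | i : 'I_k] \in E)]|.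
Proof.
move=> EU; set X := [set x | _].
rewrite -(@card_in_imset _ _ (fun x : {ffun _ -> T} => [set x i | i : 'I_k]) X).
  apply: eq_card => e; apply/idP/imsetP => [eE|[x]]; last first.
    by rewrite inE => /andP[_ ?] ->.
  have /partite_edgesP[x xU ex] := subsetP EU _ eE.
  by exists x => //; rewrite inE -ex eE andbT; apply/forallP.
by move=> x y; rewrite !inE => /andP[/forallP ? _] /andP[/forallP ? _];
   apply: choice_fun_imset_inj.
Qed.

Lemma card_partite_edges : #|partite_edges U| = \prod_(i < k) #|U i|.
Proof.
rewrite (card_edges_choice_fun (subxx _)).
transitivity #|family (fun i => mem (U i))|.
  apply: eq_card => x; rewrite inE; apply/andP/familyP => [[/forallP //]|xU].
  by split; [apply/forallP | apply/partite_edgesP; exists x].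
by rewrite card_family foldrE big_map big_enum.
Qed.

(** The embedding sends [(i, a)] to [F i a]: it is injective within a part by [is_copy] and across
    parts by disjointness. *)
Lemma is_copy_contains_copy r (H : hypergraph T) F :
  is_copy r [set x : {ffun 'I_k -> T} |
    [forall i, x i \in U i] && ([set x i | i : 'I_k] \in edges H)] F ->
  contains_copy (complete_partite_r k r) H.
Proof.
move=> /andP[/forallP Finj /forallP FH].
have FU i a : F i a \in U i.
  by have := FH [ffun=> a]; rewrite inE => /andP[/forallP/(_ i)]; rewrite !ffunE.
have FE (j : {ffun 'I_k -> 'I_r}) : [set F i (j i) | i : 'I_k] \in edges H.
  have := FH j; rewrite inE => /andP[_].
  by rewrite (eq_imset _ (fun i => ffunE _ i)).
exists (fun v => F v.1 v.2); split.
- move=> [i a] [j b] _ _ /= Fij.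
  have ij : i = j.
    apply: contraTeq (FU i a) => /disjU/pred0P/(_ (F j b)).
    by rewrite /= FU Fij andbT => /negbT.
  by rewrite -ij in Fij *; rewrite (injectiveP _ (Finj i) _ _ Fij).
- move=> [i a] _; apply: (subsetP (edges_verts (FE [ffun=> a]))).
  by apply/imsetP; exists i; rewrite ?ffunE.
(* An edge meets each part once, so it is the graph of some [j]. *)
- move=> e; rewrite inE => /and3P[_ _ /forallP e1].
  have /fin_all_exists[j jP] i :
      exists a, e :&: [set x : 'I_k * 'I_r | x.1 == i] = [set (i, a)].
    have /cards1P[[i' a] E] := e1 i.
    have : (i', a) \in e :&: [set x : 'I_k * 'I_r | x.1 == i] by rewrite E set11.
    by rewrite !inE => /andP[_ /eqP/= ii']; exists a; rewrite E ii'.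
  have je i a : ((i, a) \in e) = (a == j i).
    have := jP i => /setP/(_ (i, a)); rewrite !inE eqxx andbT => ->.
    by rewrite xpair_eqE eqxx.
  rewrite (_ : _ @: e = [set F i (finfun j i) | i : 'I_k]) //.
  apply/setP=> v; apply/imsetP/imsetP => [[[i a]]|[i _ ->]].
    by rewrite je => /eqP -> ->; exists i; rewrite ?ffunE.
  by exists (i, j i); rewrite ?je ?ffunE.
Qed.

End PartiteEdges.

Lemma geom_qE (R : realType) (k r : nat) : (2 <= r)%N ->
  geom_q R k r = (\sum_(i < k) r ^ i)%N%:R.
Proof.
move=> hr; rewrite /geom_q subrX1 mulrAC divff ?mul1r.
  by rewrite natr_sum; apply: eq_bigr => i _; rewrite natrX.
by rewrite subr_eq0 pnatr_eq1; case: r hr => [|[]].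
Qed.

(* The index i : 'I_k is 0-based, so it stands for i - 1 in the exponents. *)
Theorem theorem3p5 (R : realType) (k r : nat)
    (hk : (2 <= k)%N) (hr : (2 <= r)%N) :
  let q : R := geom_q R k r in
  exists C : R, 0 < C /\
    forall (m : nat) (T : finType) (U : 'I_k -> {set T}),
      (forall i j : 'I_k, i != j -> [disjoint U i & U j]) ->
      (forall i : 'I_k, #|U i|%:R = m%:R `^ (r%:R ^+ i / q)) ->
      let G := complete_partite U in
      #|edges G| = m /\
      forall H : hypergraph T,
        subhypergraph H G ->
        ~ contains_copy (complete_partite_r k r) H ->
        #|edges H|%:R <= C * m%:R `^ ((q - 1) / q).
Proof.
move=> q; have r_gt0 : (0 < r)%N by apply: ltnW.
pose Q := (\sum_(i < k) r ^ i)%N.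
have qE : q = Q%:R by apply: geom_qE.
pose i0 : 'I_k := Ordinal (ltnW hk).
have Q_gt0 : (0 < Q)%N by rewrite /Q (bigD1 i0).
have q_neq0 : q != 0 by rewrite qE pnatr_eq0 -lt0n.
exists (k * r.-1)%:R; split.
  by rewrite ltr0n muln_gt0 ltnW // -ltnS prednK.
move=> m T U disjU cU G.
(* The first part has size [m ^ (1 / q)], so this root is an integer and the other parts are integer
   powers of it. *)
pose t := #|U i0|.
have tE : t%:R = m%:R `^ q^-1 :> R by rewrite /t cU expr0 div1r.
have tX n : (t ^ n)%N%:R = m%:R `^ (n%:R / q) :> R.
  by rewrite natrX tE mulrC powRrM powR_mulrn ?powR_ge0.
have cUt i : #|U i| = (t ^ (r ^ i))%N.
  by apply/eqP; rewrite -(eqr_nat R) tX cU natrX.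
have tQ : (t ^ Q)%N = m.
  by apply/eqP; rewrite -(eqr_nat R) tX -qE divff ?powRr1.
have cG : #|edges G| = m.
  rewrite /= card_partite_edges // -tQ expn_sum.
  by apply: eq_bigr => i _; rewrite cUt.
split=> // H [_ HG] noK.
(* The factor [t] in [partite_turan] can be cancelled only if it is positive; if [t = 0] then
   [m = 0] and there are no edges. *)
have [t0|t_gt0] := posnP t.
  have -> : #|edges H| = 0%N.
    apply/eqP; rewrite -leqn0 (leq_trans (subset_leq_card HG)) //.
    by rewrite cG -tQ t0 exp0n.
  by rewrite mulr_ge0 ?ler0n ?powR_ge0.
have -> : (q - 1) / q = Q.-1%:R / q by rewrite qE -{1}(prednK Q_gt0) -natr1 addrK.
rewrite -tX -natrM ler_nat -(leq_pmul2r t_gt0) -mulnA -expnSr prednK //.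
rewrite (card_edges_choice_fun disjU HG).
apply: (partite_turan r_gt0 cUt) => [x|].
  by rewrite inE => /andP[/forallP].
by apply/existsP=> -[F] /(is_copy_contains_copy disjU).
Qed.
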